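(* Let $P=A\oplus B$ be a non-unital Boolean ring, where $A$ and $B$ are ideals of $P$, such that either $A$ or $B$ is a principal ideal of $P$. Then $\mathrm{B}(A,B)\cong \mathrm{T}(P)$ or $\mathrm{B}(A,B)\cong \mathrm{T}(P,\circ)$ as trusses.
   Context: An Abelian heap is a set $H$ with a ternary operation $[-,-,-]$ such that for all $a_1,\dots,a_5\in H$: $[[a_1,a_2,a_3],a_4,a_5]=[a_1,a_2,[a_3,a_4,a_5]]$; $[a_1,a_2,a_2]=a_1$ and $[a_2,a_1,a_1]=a_2$; $[a_1,a_2,a_3]=[a_3,a_2,a_1]$. A truss is an Abelian heap $(T,[-,-,-])$ with an associative binary operation $\cdot$ satisfying $a\cdot[b,c,d]=[a\cdot b,a\cdot c,a\cdot d]$ and $[b,c,d]\cdot a=[b\cdot a,c\cdot a,d\cdot a]$. A truss isomorphism is a bijection preserving both operations; direct products carry componentwise operations. Rings are associative and need not be unital; a Boolean ring is a (not necessarily unital) ring in which $x^2=x$ for all $x$; non-unital means having no multiplicative identity. $P=A\oplus B$ means that $P$ is the internal direct sum of the ideals $A$ and $B$. For a ring $R$, $\mathrm{T}(R)$ is the set $R$ with heap operation $[a,b,c]=a-b+c$ and the ring multiplication, and $\mathrm{T}(R,\circ)$ is the set $R$ with the same heap operation and multiplication $a\circ b=a+b+ab$. For ideals $A,B$ of $P$ with $P=A\oplus B$ (regarded as rings), $\mathrm{B}(A,B):=\mathrm{T}(A,\circ)\times \mathrm{T}(B)$. *)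

(* Defs.v *)
From HB Require Import structures.
From mathcomp Require Import all_boot all_order ssralg.
From mathcomp Require Import boolp classical_sets.

Set Implicit Arguments.
Unset Strict Implicit.
Unset Printing Implicit Defensive.

Import GRing.Theory.

Local Open Scope classical_set_scope.
Local Open Scope ring_scope.

(* The other Mal'cev identity [b, b, a] = a follows from [heap_opK] and
   [heap_opC]. *)
HB.mixin Record isAbelianHeap H := {
  heap_op : H -> H -> H -> H;
  heap_opA : forall a b c d e,
    heap_op (heap_op a b c) d e = heap_op a b (heap_op c d e);
  heap_opK : forall a b, heap_op a b b = a;
  heap_opC : forall a b c, heap_op a b c = heap_op c b a
}.

#[short(type="heapType")]
HB.structure Definition AbelianHeap := { H of isAbelianHeap H }.

HB.mixin Record AbelianHeap_isTruss T of AbelianHeap T := {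
  truss_mul : T -> T -> T;
  truss_mulA : associative truss_mul;
  truss_mul_heapr : forall a b c d : T,
    truss_mul a (heap_op b c d) =
    heap_op (truss_mul a b) (truss_mul a c) (truss_mul a d);
  truss_mul_heapl : forall a b c d : T,
    truss_mul (heap_op b c d) a =
    heap_op (truss_mul b a) (truss_mul c a) (truss_mul d a)
}.

#[short(type="trussType")]
HB.structure Definition Truss := { T of AbelianHeap T & AbelianHeap_isTruss T }.

Definition truss_iso (S T : trussType) : Prop :=
  exists f : S -> T,
    [/\ bijective f,
        forall a b c, f (heap_op a b c) = heap_op (f a) (f b) (f c)
      & {morph f : a b / truss_mul a b}].

Section ProductTruss.

Section Heap.
Variables S T : heapType.

Definition prod_heap_op (a b c : S * T) : S * T :=
  (heap_op a.1 b.1 c.1, heap_op a.2 b.2 c.2).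

Lemma prod_heap_opA a b c d e :
  prod_heap_op (prod_heap_op a b c) d e = prod_heap_op a b (prod_heap_op c d e).
Proof. by rewrite /prod_heap_op /= !heap_opA. Qed.

Lemma prod_heap_opK a b : prod_heap_op a b b = a.
Proof. by case: a => a1 a2; rewrite /prod_heap_op /= !heap_opK. Qed.

Lemma prod_heap_opC a b c : prod_heap_op a b c = prod_heap_op c b a.
Proof. by congr pair; exact: heap_opC. Qed.

HB.instance Definition _ := isAbelianHeap.Build (S * T)%type
  prod_heap_opA prod_heap_opK prod_heap_opC.

End Heap.

Variables S T : trussType.

Definition prod_truss_mul (a b : S * T) : S * T :=
  (truss_mul a.1 b.1, truss_mul a.2 b.2).

Lemma prod_truss_mulA : associative prod_truss_mul.
Proof. by move=> a b c; rewrite /prod_truss_mul /= !truss_mulA. Qed.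

Lemma prod_truss_mul_heapr (a b c d : S * T) :
  prod_truss_mul a (heap_op b c d) =
  heap_op (prod_truss_mul a b) (prod_truss_mul a c) (prod_truss_mul a d).
Proof. by congr pair; exact: truss_mul_heapr. Qed.

Lemma prod_truss_mul_heapl (a b c d : S * T) :
  prod_truss_mul (heap_op b c d) a =
  heap_op (prod_truss_mul b a) (prod_truss_mul c a) (prod_truss_mul d a).
Proof. by congr pair; exact: truss_mul_heapl. Qed.

HB.instance Definition _ := AbelianHeap_isTruss.Build (S * T)%type
  prod_truss_mulA prod_truss_mul_heapr prod_truss_mul_heapl.

End ProductTruss.

(* Associative rings without a required identity: the rings of ssralg are all
   unital. *)
HB.mixin Record Zmodule_isRng R of GRing.Zmodule R := {
  rng_mul : R -> R -> R;
  rng_mulA : associative rng_mul;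
  rng_mulDl : left_distributive rng_mul +%R;
  rng_mulDr : right_distributive rng_mul +%R
}.

#[short(type="rngType")]
HB.structure Definition Rng := { R of GRing.Zmodule R & Zmodule_isRng R }.

Section RngTheory.
Variable R : rngType.
Local Notation "x ** y" := (@rng_mul R x y) (at level 40, left associativity).
Implicit Types x y z : R.

Lemma rng_mulBl x y z : (x - y) ** z = x ** z - y ** z.
Proof. by apply/eqP; rewrite eq_sym subr_eq -rng_mulDl subrK. Qed.

Lemma rng_mulBr x y z : x ** (y - z) = x ** y - x ** z.
Proof. by apply/eqP; rewrite eq_sym subr_eq -rng_mulDr subrK. Qed.

Definition boolean_rng : Prop := forall x, x ** x = x.

Definition unital_rng : Prop := exists e, forall x, e ** x = x /\ x ** e = x.

Definition is_ideal (I : set R) : Prop :=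
  [/\ I 0,
      forall x y, I x -> I y -> I (x - y)
    & forall r x, I x -> I (r ** x) /\ I (x ** r)].

End RngTheory.

Record ideal (R : rngType) := Ideal {
  ideal_set :> set R;
  ideal_setP : is_ideal ideal_set
}.

(* The ideal generated by [a] is the least ideal containing [a]; without an
   identity it can be larger than the set of multiples of [a]. *)
Definition principal_ideal (R : rngType) (I : ideal R) : Prop :=
  exists a : R, ideal_set I = smallest (@is_ideal R) [set a].

Definition internal_direct_sum (R : rngType) (A B : ideal R) : Prop :=
  (forall x : R, exists a b : R, [/\ ideal_set A a, ideal_set B b & x = a + b]) /\
  A `&` B = [set 0].

Definition ideal_rng (R : rngType) (I : ideal R) : Type := set_type I.

Section IdealRng.
Variables (R : rngType) (I : ideal R).

HB.instance Definition _ := SubChoice.on (ideal_rng I).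

Lemma ideal_zmod_closed : zmod_closed [pred x | x \in ideal_set I].
Proof.
case: (ideal_setP I) => I0 IB _; split; first by rewrite inE.
by move=> x y; rewrite !inE; exact: IB.
Qed.

HB.instance Definition _ :=
  GRing.SubChoice_isSubZmodule.Build R _ (ideal_rng I) ideal_zmod_closed.

Implicit Types x y z : ideal_rng I.

Lemma ideal_rng_mul_subproof x y : rng_mul (val x) (val y) \in ideal_set I.
Proof.
case: (ideal_setP I) => _ _ IM; rewrite inE; apply: (IM _ _ _).1.
by have := valP y; rewrite inE.
Qed.

Definition ideal_rng_mul x y : ideal_rng I := SigSub (ideal_rng_mul_subproof x y).

Lemma ideal_rng_mulA : associative ideal_rng_mul.
Proof. by move=> x y z; apply: val_inj; rewrite /= rng_mulA. Qed.

Lemma ideal_rng_mulDl : left_distributive ideal_rng_mul +%R.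
Proof. by move=> x y z; apply: val_inj; rewrite /= ?raddfD rng_mulDl. Qed.

Lemma ideal_rng_mulDr : right_distributive ideal_rng_mul +%R.
Proof. by move=> x y z; apply: val_inj; rewrite /= ?raddfD rng_mulDr. Qed.

HB.instance Definition _ := Zmodule_isRng.Build (ideal_rng I)
  ideal_rng_mulA ideal_rng_mulDl ideal_rng_mulDr.

End IdealRng.

Section RngHeap.
Variable V : zmodType.

Definition zmod_heap_op (a b c : V) : V := a - b + c.

Lemma zmod_heap_opA a b c d e :
  zmod_heap_op (zmod_heap_op a b c) d e = zmod_heap_op a b (zmod_heap_op c d e).
Proof. by rewrite /zmod_heap_op !addrA. Qed.

Lemma zmod_heap_opK a b : zmod_heap_op a b b = a.
Proof. exact: subrK. Qed.

Lemma zmod_heap_opC a b c : zmod_heap_op a b c = zmod_heap_op c b a.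
Proof. by rewrite /zmod_heap_op addrAC [a + c]addrC addrAC. Qed.

End RngHeap.

(* T(R) and T(R, o) live on the same carrier, hence two aliases of [R]. *)
Definition rng_truss (R : rngType) : Type := R.
Definition circ_truss (R : rngType) : Type := R.

Section RngTruss.
Variable R : rngType.

HB.instance Definition _ := isAbelianHeap.Build (rng_truss R)
  (@zmod_heap_opA R) (@zmod_heap_opK R) (@zmod_heap_opC R).

Lemma rng_mul_heapr (a b c d : R) :
  rng_mul a (zmod_heap_op b c d) =
  zmod_heap_op (rng_mul a b) (rng_mul a c) (rng_mul a d).
Proof. by rewrite /zmod_heap_op rng_mulDr rng_mulBr. Qed.

Lemma rng_mul_heapl (a b c d : R) :
  rng_mul (zmod_heap_op b c d) a =
  zmod_heap_op (rng_mul b a) (rng_mul c a) (rng_mul d a).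
Proof. by rewrite /zmod_heap_op rng_mulDl rng_mulBl. Qed.

HB.instance Definition _ := AbelianHeap_isTruss.Build (rng_truss R)
  (@rng_mulA R) rng_mul_heapr rng_mul_heapl.

HB.instance Definition _ := isAbelianHeap.Build (circ_truss R)
  (@zmod_heap_opA R) (@zmod_heap_opK R) (@zmod_heap_opC R).

Definition circ_mul (a b : R) : R := a + b + rng_mul a b.

Lemma circ_mulA : associative circ_mul.
Proof.
move=> a b c; rewrite /circ_mul !rng_mulDr !rng_mulDl !rng_mulA !addrA.
congr (_ + _); rewrite -!addrA; congr (_ + (_ + _)).
by rewrite [RHS]addrCA; congr (_ + _); rewrite addrC -addrA.
Qed.

Lemma zmod_heap_opD (a a' b b' c c' : R) :
  zmod_heap_op (a + a') (b + b') (c + c') =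
  zmod_heap_op a b c + zmod_heap_op a' b' c'.
Proof. by rewrite /zmod_heap_op opprD [a + a' + _]addrACA [LHS]addrACA. Qed.

Lemma zmod_heap_opxx (a : R) : zmod_heap_op a a a = a.
Proof. exact: subrK. Qed.

Lemma circ_mul_heapr (a b c d : R) :
  circ_mul a (zmod_heap_op b c d) =
  zmod_heap_op (circ_mul a b) (circ_mul a c) (circ_mul a d).
Proof. by rewrite /circ_mul !zmod_heap_opD zmod_heap_opxx rng_mul_heapr. Qed.

Lemma circ_mul_heapl (a b c d : R) :
  circ_mul (zmod_heap_op b c d) a =
  zmod_heap_op (circ_mul b a) (circ_mul c a) (circ_mul d a).
Proof. by rewrite /circ_mul !zmod_heap_opD zmod_heap_opxx rng_mul_heapl. Qed.

HB.instance Definition _ := AbelianHeap_isTruss.Build (circ_truss R)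
  circ_mulA circ_mul_heapr circ_mul_heapl.

End RngTruss.

Definition B_truss (R : rngType) (A B : ideal R) : trussType :=
  (circ_truss (ideal_rng A) * rng_truss (ideal_rng B))%type.

(* Main.v *)
From mathcomp Require Import all_boot ssralg.
From mathcomp Require Import boolp classical_sets.
Require Import Defs.

(** In a ring with identity [e], translation by [e] turns the circle product
    into the ring product, since [(x + e)(y + e) = x + y + xy + e]; a
    translation is a heap isomorphism, so [T(R, o)] and [T(R)] are isomorphic
    ([circ_truss_iso_of_unital]).  A principal ideal of a Boolean ring always
    has an identity, namely its generator
    ([boolean_principal_ideal_unital]).  Hence if [A] is principal the factor
    [T(A, o)] of [B(A, B)] may be replaced by [T(A)], and if [B] is principal
    the factor [T(B)] may be replaced by [T(B, o)].  Both factors are then of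
    the same kind, and since [P] is the product of the rings [A] and [B], their
    product is [T(P)] in the first case ([direct_sum_rng_truss_iso]) and
    [T(P, o)] in the second ([direct_sum_circ_truss_iso]). *)

Set Implicit Arguments.
Unset Strict Implicit.
Unset Printing Implicit Defensive.

Import GRing.Theory.

Local Open Scope classical_set_scope.
Local Open Scope ring_scope.

Lemma truss_iso_refl (T : trussType) : truss_iso T T.
Proof. by exists id; split=> //; exists id. Qed.

Lemma truss_iso_sym (S T : trussType) : truss_iso S T -> truss_iso T S.
Proof.
case=> f [[g fK gK] fH fM]; exists g; split; first by exists f.
  by move=> a b c; apply: (can_inj fK); rewrite gK fH !gK.
by move=> a b; apply: (can_inj fK); rewrite gK fM !gK.
Qed.

Lemma truss_iso_trans (S T U : trussType) :
  truss_iso S T -> truss_iso T U -> truss_iso S U.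
Proof.
case=> f [fB fH fM] [g [gB gH gM]]; exists (g \o f); split.
- exact: bij_comp.
- by move=> a b c /=; rewrite fH gH.
- by move=> a b /=; rewrite fM gM.
Qed.

Lemma truss_iso_prod (S S' T T' : trussType) :
  truss_iso S S' -> truss_iso T T' ->
  truss_iso (S * T)%type (S' * T')%type.
Proof.
case=> f [[f' fK f'K] fH fM] [g [[g' gK g'K] gH gM]].
exists (fun p => (f p.1, g p.2)); split.
- by exists (fun p => (f' p.1, g' p.2)) => -[x y] /=;
     rewrite ?fK ?gK ?f'K ?g'K.
- by move=> a b c; congr pair; [exact: fH | exact: gH].
- by move=> a b; congr pair; [exact: fM | exact: gM].
Qed.

(** The translation is [x |-> x + e] with [e] the identity: it sends the
    neutral element [0] of [o] to the neutral element [e] of the product. *)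
Lemma circ_truss_iso_of_unital (R : rngType) :
  unital_rng R -> truss_iso (circ_truss R) (rng_truss R).
Proof.
case=> e eP; exists (fun x : R => x + e); split.
- by exists (fun x : R => x - e) => x; rewrite ?addrK ?subrK.
- move=> a b c; rewrite -[X in _ + X](zmod_heap_opxx e).
  by rewrite -[LHS]zmod_heap_opD.
- move=> a b; change (a + b + rng_mul a b + e = rng_mul (a + e) (b + e) :> R).
  rewrite rng_mulDl !rng_mulDr !(eP _).1 (eP a).2.
  by rewrite [a + b + _]addrC addrA [RHS]addrA.
Qed.

(** Expanding [(x + x)^2 = x + x] gives characteristic two, and expanding
    [(x + y)^2 = x + y] gives [xy = - yx]. *)
Lemma boolean_rng_mulC (R : rngType) :
  boolean_rng R -> commutative (@rng_mul R).
Proof.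
move=> hb x y.
have char2 (z : R) : z + z = 0.
  have := hb (z + z); rewrite rng_mulDl !rng_mulDr !hb => /eqP.
  by rewrite -subr_eq0 addrK => /eqP.
have anti : rng_mul x y + rng_mul y x = 0.
  apply: (addrI x); apply: (addIr y).
  by rewrite addr0 -[RHS]hb rng_mulDl !rng_mulDr !hb !addrA.
by apply: (addIr (rng_mul y x)); rewrite anti char2.
Qed.

(** For an idempotent [a] of a commutative ring the fixed points of
    multiplication by [a] form an ideal containing [a], hence containing the
    ideal that [a] generates. *)
Lemma boolean_principal_ideal_unital (R : rngType) (I : ideal R) :
  boolean_rng R -> principal_ideal I -> unital_rng (ideal_rng I).
Proof.
move=> hb [a Ia]; have mC := boolean_rng_mulC hb.
have aI : a \in ideal_set I.
  by rewrite inE Ia => J [_]; apply.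
have aid x : ideal_set I x -> rng_mul a x = x.
  rewrite Ia; apply: (smallest_sub (X := [set y | rng_mul a y = y])).
    split=> /= [|y z ay az|r y ay].
    - by rewrite -(subrr a) rng_mulBr hb.
    - by rewrite rng_mulBr ay az.
    - have ayr : rng_mul a (rng_mul y r) = rng_mul y r by rewrite rng_mulA ay.
      by rewrite [rng_mul r y]mC.
  by move=> _ /= ->; exact: hb.
exists (SigSub aI) => x.
have xI : ideal_set I (val x) by have := valP x; rewrite inE.
by split; apply: val_inj; rewrite /= ?[rng_mul _ a]mC aid.
Qed.

Section DirectSum.
Variables (P : rngType) (A B : ideal P).
Hypothesis hsum : internal_direct_sum A B.

Let sum_map (p : ideal_rng A * ideal_rng B) : P := val p.1 + val p.2.

Lemma direct_sum_eq0 x : ideal_set A x -> ideal_set B x -> x = 0.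
Proof. by move=> Ax Bx; suff : (A `&` B) x by rewrite hsum.2. Qed.

Lemma direct_sum_bij : bijective sum_map.
Proof.
have inj : injective sum_map.
  move=> [a b] [a' b']; rewrite /sum_map /= => eq_sums.
  have eq_diff : val (a - a') = val (b' - b).
    rewrite !raddfB; apply/eqP.
    by rewrite subr_eq addrAC eq_sym subr_eq eq_sym [val b' + _]addrC eq_sums.
  have diff0 : val (a - a') = 0.
    apply: direct_sum_eq0; first by have := valP (a - a'); rewrite inE.
    by rewrite eq_diff; have := valP (b' - b); rewrite inE.
  have /subr0_eq -> : a - a' = 0 by apply: val_inj; rewrite [LHS]diff0 raddf0.
  have /subr0_eq -> // : b' - b = 0.
  by apply: val_inj; rewrite -[LHS]eq_diff [LHS]diff0 raddf0.
have surj x : exists p, sum_map p = x.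
  case: (hsum.1 x) => a [b [aA bB ->]].
  by exists (SigSub (mem_set aA), SigSub (mem_set bB)).
have [g gK] := choice surj.
by exists g => // p; apply: inj; rewrite gK.
Qed.

Lemma sum_map_heap p q r :
  sum_map (zmod_heap_op p.1 q.1 r.1, zmod_heap_op p.2 q.2 r.2) =
  zmod_heap_op (sum_map p) (sum_map q) (sum_map r).
Proof.
rewrite /sum_map zmod_heap_opD.
by congr (_ + _); rewrite [LHS]raddfD raddfB.
Qed.

(** The cross terms of the product lie in both ideals, hence vanish. *)
Lemma sum_map_mul p q :
  sum_map (rng_mul p.1 q.1, rng_mul p.2 q.2) =
  rng_mul (sum_map p) (sum_map q).
Proof.
have ann (a : ideal_rng A) (b : ideal_rng B) :
    rng_mul (val a) (val b) = 0 /\ rng_mul (val b) (val a) = 0.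
  have aA : ideal_set A (val a) by have := valP a; rewrite inE.
  have bB : ideal_set B (val b) by have := valP b; rewrite inE.
  have [_ _ /(_ (val b) _ aA) [ba ab]] := ideal_setP A.
  have [_ _ /(_ (val a) _ bB) [ab' ba']] := ideal_setP B.
  by split; apply: direct_sum_eq0.
rewrite /sum_map rng_mulDl !rng_mulDr.
by rewrite (ann p.1 q.2).1 (ann q.1 p.2).2 addr0 add0r.
Qed.

Lemma direct_sum_rng_truss_iso :
  truss_iso (rng_truss (ideal_rng A) * rng_truss (ideal_rng B))%type
            (rng_truss P).
Proof.
exists sum_map; split.
- exact: direct_sum_bij.
- exact: sum_map_heap.
- exact: sum_map_mul.
Qed.

Lemma direct_sum_circ_truss_iso :
  truss_iso (circ_truss (ideal_rng A) * circ_truss (ideal_rng B))%type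
            (circ_truss P).
Proof.
exists sum_map; split.
- exact: direct_sum_bij.
- exact: sum_map_heap.
move=> p q; change (sum_map (circ_mul p.1 q.1, circ_mul p.2 q.2) =
  circ_mul (sum_map p) (sum_map q)).
have val_circ (I : ideal P) (x y : ideal_rng I) :
    val (circ_mul x y) = val x + val y + val (rng_mul x y).
  by rewrite [LHS]raddfD raddfD.
rewrite [RHS]/circ_mul -sum_map_mul /sum_map !val_circ addrACA.
by congr (_ + _); rewrite addrACA.
Qed.

End DirectSum.

Theorem corollary3p14 (P : rngType) (A B : ideal P)
    (hbool : boolean_rng P)
    (hnonunital : ~ unital_rng P)
    (hsum : internal_direct_sum A B)
    (hprincipal : principal_ideal A \/ principal_ideal B) :
  truss_iso (B_truss A B) (rng_truss P) \/
  truss_iso (B_truss A B) (circ_truss P).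
Proof.
case: hprincipal => /(boolean_principal_ideal_unital hbool)
  /circ_truss_iso_of_unital circI; [left|right].
- apply: truss_iso_trans (direct_sum_rng_truss_iso hsum).
  by apply: truss_iso_prod => //; exact: truss_iso_refl.
- apply: truss_iso_trans (direct_sum_circ_truss_iso hsum).
  by apply: truss_iso_prod; [exact: truss_iso_refl | exact: truss_iso_sym].
Qed.
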